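(* Let $D$ be a Prüfer domain such that $\mathrm{Spec}(D)$ is a Noetherian space (in the Zariski topology). Then $\mathrm{Spec}(D)$ is compactly layered.
   Context: The inverse topology on the spectrum of a ring $R$ is the topology having as a subbasis of open sets the sets $\mathcal V(I)=\{P\in\mathrm{Spec}(R)\mid I\subseteq P\}$, for $I$ a finitely generated ideal. $\mathrm{Spec}(R)$ is compactly layered if there is a well-ordered sequence $\{Y_\alpha\}_{\alpha<\lambda}$ (indexed by ordinals) of subsets of $\mathrm{Spec}(R)$ such that: $Y_0=\mathrm{Spec}(R)$; $Y_\gamma=\emptyset$ for some $\gamma$; $Y_\alpha\subseteq Y_\beta$ if $\alpha>\beta$; if $\alpha$ is a limit ordinal, $Y_\alpha=\bigcap_{\beta<\alpha}Y_\beta$; each $Y_\alpha$ is closed in the inverse topology; and for every $\alpha$, $Y_\alpha\setminus Y_{\alpha+1}\subseteq\mathrm{Max}(Y_\alpha)$, where $\mathrm{Max}(Y_\alpha)$ is the set of elements of $Y_\alpha$ that are maximal under inclusion. *)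

(* Defs.v *)
From HB Require Import structures.
From mathcomp Require Import all_boot all_order all_algebra.
From mathcomp Require Import all_classical.
From mathcomp Require Import topology.

Set Implicit Arguments.
Unset Strict Implicit.
Unset Printing Implicit Defensive.

Import Order.TTheory GRing.Theory.
Local Open Scope classical_set_scope.
Local Open Scope ring_scope.

Section Spectrum.
Variable R : comNzRingType.

(* [idealr_closed] includes properness. *)
Definition prime_ideal (P : set R) : Prop :=
  idealr_closed [in P] /\ prime_idealr_closed [in P].

(* The unit ideal and the zero ideal are both finitely generated ideals. *)
Definition fg_ideal (I : set R) : Prop :=
  exists (n : nat) (a : 'I_n -> R),
    I = [set x | exists c : 'I_n -> R, x = \sum_(i < n) c i * a i].

Record spec : Type := Spec {
  spec_set :> set R;
  spec_prime : prime_ideal spec_set }.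

(* V(E); this is V(I) for I the ideal generated by E. *)
Definition zeros (E : set R) : set spec := [set P : spec | E `<=` P].

Definition max_elements (Y : set spec) : set spec :=
  [set P | Y P /\ forall Q : spec, Y Q -> P `<=` Q -> spec_set Q = P].

End Spectrum.

(* Two copies of [spec R], since a type carries at most one canonical
   topology. *)
Definition zariski_spec (R : comNzRingType) : Type := spec R.
Definition inverse_spec (R : comNzRingType) : Type := spec R.

Section Zariski.
Variable R : comNzRingType.

Definition zariski_open : set_system (zariski_spec R) :=
  [set U | exists E : set R, U = ~` zeros E].

Lemma zariski_openT : zariski_open setT.
Proof.
exists setT; apply/seteqP; split=> // P _ /(_ 1 I).
by case: (spec_prime P) => -[_ /negP + _] _ P1; apply; rewrite in_setE.
Qed.

Lemma zariski_openI : setI_closed zariski_open.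
Proof.
move=> _ _ [E ->] [F ->].
exists [set x | exists e f, [/\ E e, F f & x = e * f]].
rewrite -setCU; congr (~` _); apply/seteqP; split=> P.
- case: (spec_prime P) => -[P0 _ PD] _.
  have PM a u : spec_set P u -> spec_set P (a * u).
    by move=> /mem_set Pu; have := PD a u 0 Pu P0; rewrite addr0 => /set_mem.
  case=> PE _ [e [f [Ee Ff ->]]]; last exact/PM/PE.
  by rewrite mulrC; exact/PM/PE.
- move=> PEF; have [|PE] := pselect (E `<=` P); first by left.
  right=> f Ff; apply: contrapT => Pf; apply: PE => e Ee.
  have /mem_set : spec_set P (e * f) by apply: PEF; exists e, f.
  by case: (spec_prime P) => _ /[apply] /orP[] /set_mem.
Qed.

Lemma zariski_open_bigU (J : Type) (f : J -> set (zariski_spec R)) :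
  (forall i, zariski_open (f i)) -> zariski_open (\bigcup_i f i).
Proof.
move=> /choice[E fE]; exists (\bigcup_i E i).
rewrite -[LHS]setCK setC_bigcup; congr (~` _); apply/seteqP; split=> P.
- by move=> Pf x [i _ Eix]; have := Pf i I; rewrite fE setCK; exact.
- by move=> PE i _; rewrite fE setCK => x Eix; apply: PE; exists i.
Qed.

HB.instance Definition _ := gen_eqMixin (zariski_spec R).
HB.instance Definition _ := gen_choiceMixin (zariski_spec R).
HB.instance Definition _ := isOpenTopological.Build (zariski_spec R)
  zariski_openT zariski_openI zariski_open_bigU.

End Zariski.

Section Inverse.
Variable R : comNzRingType.

HB.instance Definition _ := gen_eqMixin (inverse_spec R).
HB.instance Definition _ := gen_choiceMixin (inverse_spec R).
(* The subbase is the family of the V(I), for I finitely generated. *)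
HB.instance Definition _ := isSubBaseTopological.Build (inverse_spec R)
  [set I : set R | fg_ideal I] (@zeros R).

End Inverse.

(* Ascending chain condition on open sets. *)
Definition noetherian_space (T : topologicalType) : Prop :=
  forall U : nat -> set T, (forall n, open (U n)) ->
    (forall n, U n `<=` U n.+1) ->
    exists N : nat, forall n, (N <= n)%N -> U n = U N.

Section Prufer.
Variable D : idomainType.
Local Notation K := {fraction D}.
Local Notation iota := (@FracField.tofrac D).

Definition fractional_ideal (J : set K) : Prop :=
  [/\ J 0, forall x y, J x -> J y -> J (x + y),
      forall (a : D) x, J x -> J (iota a * x) &
      exists2 d : D, d != 0 & forall x, J x -> range iota (iota d * x)].

Definition ideal_prod (I J : set K) : set K :=
  [set z | exists (n : nat) (x y : 'I_n -> K),
    [/\ forall i, I (x i), forall i, J (y i) & z = \sum_(i < n) x i * y i]].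

Definition invertible_ideal (I : set D) : Prop :=
  exists2 J : set K, fractional_ideal J & ideal_prod (iota @` I) J = range iota.

Definition prufer_domain : Prop :=
  forall I : set D, fg_ideal I -> I <> [set 0] -> invertible_ideal I.

End Prufer.

(* A well-ordered type [W] stands for the ordinal lambda indexing the sequence:
   its least element is 0, and the following relations single out successor
   and limit ordinals below lambda. *)
Section WellOrderedIndex.
Context {d : Order.disp_t} {W : porderType d}.

Definition is_zero (a : W) : Prop := forall b : W, (a <= b)%O.

Definition is_succ (a a' : W) : Prop :=
  (a < a')%O /\ forall b : W, (a < b)%O -> (a' <= b)%O.

Definition is_limit (a : W) : Prop :=
  ~ is_zero a /\ ~ exists b : W, is_succ b a.

End WellOrderedIndex.

Definition compactly_layered (R : comNzRingType) : Prop :=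
  exists (d : Order.disp_t) (W : orderType d) (Y : W -> set (spec R)),
  [/\ wochoice.well_order (<=%O : rel W),
      forall a, is_zero a -> Y a = setT,
      exists c, Y c = set0,
      forall a b, (b < a)%O -> Y a `<=` Y b &
  [/\ forall a, is_limit a -> Y a = \bigcap_(b in [set b | (b < a)%O]) Y b,
      forall a, closed (Y a : set (inverse_spec R)) &
      forall a a', is_succ a a' -> Y a `\` Y a' `<=` max_elements (Y a)]].

(* Main.v *)
Require Import Defs.
From HB Require Import structures.
From mathcomp Require Import all_boot all_order all_algebra.
From mathcomp Require Import all_classical.
From mathcomp Require Import topology.

(** In a ring with Noetherian spectrum the primes can be removed one at a
    time, larger primes first, and every stage of this process is closed in
    the inverse topology.

    Two consequences of Noetherianity carry the argument, and both come from
    the fact that a nonempty family of sets [zeros E] has a minimal member.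
    Every [zeros E] is [zeros I] for a finitely generated [I]
    ([noetherian_zeros_fg]), so it is open in the inverse topology; as a set
    [Y] of primes stable under passing to smaller primes is the complement of
    the union of the [zeros P] for [P] outside [Y], such a [Y] is closed
    ([inverse_closed_generization_stable]). Moreover reverse inclusion of
    primes is well-founded ([noetherian_spec_acc]), hence it extends to a
    well-order of the spectrum ([well_order_extension]): compare ordinal
    ranks, and break ties with an arbitrary well-order.

    Add a last point to this well-order, and let [Y a] be the set of primes
    that do not come before [a]. Since larger primes come first, [Y a] is
    stable under passing to smaller primes, hence closed. It starts at the
    whole spectrum, is empty at the last point, is an intersection at limits,
    and loses only the point [a] in the step from [a] to its successor; the
    prime [a] is maximal in [Y a] because all larger primes have already been
    removed. *)

Set Implicit Arguments.
Unset Strict Implicit.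
Unset Printing Implicit Defensive.

Import Order.TTheory GRing.Theory.
Local Open Scope classical_set_scope.
Local Open Scope ring_scope.

(** * Well-orders as total orders *)

(** [T] with the order [le]; it is an alias because [T] may already carry
    another order. *)
Definition well_ordered (T : choiceType) (le : rel T)
  (_ : wochoice.well_order le) : Type := T.

Section WellOrder.
Variables (T : choiceType) (le : rel T) (le_wo : wochoice.well_order le).

Let le_chain : wochoice.wo_chain le predT.
Proof. exact: wochoice.withinW. Qed.

Lemma well_order_refl : reflexive le.
Proof. by move=> x; apply: (wochoice.wo_chain_reflexive le_chain). Qed.

Lemma well_order_anti : antisymmetric le.
Proof. by move=> x y; apply: (wochoice.wo_chain_antisymmetric le_chain). Qed.

Lemma well_order_total : total le.
Proof. by move=> x y; apply: (wochoice.wo_chainW le_chain). Qed.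

(** Any three elements have a minimum, and wherever it lies antisymmetry
    collapses a putative cycle. *)
Lemma well_order_trans : transitive le.
Proof.
move=> y x z xy yz.
have [|m [[]]] := le_wo (A := mem [:: x; y; z]).
  by exists x; rewrite inE eqxx.
rewrite !inE => mE mmin _.
have [mx my mz] : [/\ le m x, le m y & le m z].
  by split; apply: mmin; rewrite !inE eqxx ?orbT.
case/or3P: mE => /eqP mE; rewrite {}mE in mx my mz => //.
  by rewrite (@well_order_anti x y) // xy mx.
by rewrite -(@well_order_anti y z) // yz my.
Qed.

HB.instance Definition _ := Choice.copy (well_ordered le_wo) T.
HB.instance Definition _ := Order.Le_isPOrder.Build (Order.Disp tt tt)
  (well_ordered le_wo) well_order_refl well_order_anti well_order_trans.
HB.instance Definition _ := Order.POrder_isTotal.Build (Order.Disp tt tt)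
  (well_ordered le_wo) well_order_total.

End WellOrder.

(** * Extending a well-founded relation to a well-order *)

Section LinearExtension.
Variables (T : choiceType) (lt : T -> T -> Prop).

(** The comparison of ordinal ranks, without ordinals: the rank of [x] is the
    least ordinal above the ranks of all [x'] with [lt x' x]. *)
Inductive rank_le : T -> T -> Prop :=
  RankLe x y of (forall x', lt x' x -> exists2 y', lt y' y & rank_le x' y') :
    rank_le x y.

Lemma rank_le_inv x y x' :
  rank_le x y -> lt x' x -> exists2 y', lt y' y & rank_le x' y'.
Proof. by case=> {}x {}y + x'x; exact. Qed.

Hypothesis lt_wf : well_founded lt.

Lemma rank_le_refl x : rank_le x x.
Proof.
elim/(well_founded_ind lt_wf): x => x IH.
by split=> y yx; exists y => //; exact: IH.
Qed.

Lemma rank_le_trans y x z : rank_le x y -> rank_le y z -> rank_le x z.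
Proof.
elim/(well_founded_ind lt_wf): x y z => x IH y z xy yz; split=> x' x'x.
have [y' y'y x'y'] := rank_le_inv xy x'x.
have [z' z'z y'z'] := rank_le_inv yz y'y.
by exists z' => //; exact: IH y'z'.
Qed.

Lemma lt_rank_nge x y : lt x y -> ~ rank_le y x.
Proof.
elim/(well_founded_ind lt_wf): x y => x IH y xy yx.
by have [x' x'x xx'] := rank_le_inv yx xy; exact: (IH x' x'x x).
Qed.

(** An ordinal below the rank of [x] is at most the rank of some element below
    [x]; this is what makes ranks comparable and well-founded. *)
Lemma rank_nle x y : ~ rank_le x y -> exists2 x', lt x' x & rank_le y x'.
Proof.
elim/(well_founded_ind lt_wf): x y => x IH y nxy.
have [x' x'x nx'] : exists2 x', lt x' x & forall y', lt y' y -> ~ rank_le x' y'.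
  apply: contrapT => nex; apply: nxy; split=> x' x'x.
  apply: contrapT => nx'; apply: nex; exists x' => // y' y'y x'y'.
  by apply: nx'; exists y'.
by exists x' => //; split=> y' /nx'; exact: IH.
Qed.

Lemma lt_rank_le x y : lt x y -> rank_le x y.
Proof.
elim/(well_founded_ind lt_wf): x y => x IH y xy; split=> x' x'x.
by exists x => //; exact: IH.
Qed.

Lemma rank_le_min (A : set T) : A !=set0 ->
  exists2 x, A x & forall y, A y -> rank_le x y.
Proof.
(* The induction is on a bound [b] for the rank of [a], not on [a]: an element
   of smaller rank need not be related to [a] by [lt]. *)
case=> a Aa; move: (rank_le_refl a); move: {2}a => b.
elim/(well_founded_ind lt_wf): b a Aa => b IH a Aa ab.
have [amin|] := pselect (forall y, A y -> rank_le a y); first by exists a.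
move=> /existsNP[y /not_implyP[Ay /rank_nle[a' a'a ya']]].
have [b' b'b a'b'] := rank_le_inv ab a'a.
exact: IH b' b'b y Ay (rank_le_trans ya' a'b').
Qed.

(** The order is lexicographic: first the rank, then a well-order of [T]
    unrelated to [lt]. Elements related by [lt] have different ranks, so the
    second component never contradicts [lt]. *)
Lemma well_order_extension : exists le : rel T,
  wochoice.well_order le /\ forall x y, lt x y -> ~~ le y x.
Proof.
have [tie tie_wo] := wochoice.well_ordering_principle T.
exists (fun x y => `[< rank_le x y /\ (rank_le y x -> tie x y) >]).
split; last by move=> x y xy; apply/asboolP => -[/(lt_rank_nge xy)].
apply: wochoice.antisymmetric_well_order.
  move=> x y /andP[/asboolP[xy txy] /asboolP[yx tyx]].
  by apply: (well_order_anti tie_wo); rewrite txy ?tyx.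
move=> A [a aA].
have [x xA xmin] := @rank_le_min [set x | x \in A] (ex_intro _ a aA).
have [|m [[/asboolP[mA mx] mmin] _]] :=
    tie_wo [pred y | `[< y \in A /\ rank_le y x >]].
  by exists x; apply/asboolP; split => //; exact: rank_le_refl.
exists m; split=> // y yA; apply/asboolP; split.
  exact: rank_le_trans mx (xmin y yA).
by move=> ym; apply: mmin; apply/asboolP; split=> //; exact: rank_le_trans ym mx.
Qed.

End LinearExtension.

(** * Noetherian spectra *)

(** The usual maximal condition; dependent choice turns a family without
    maximal member into a strictly increasing sequence. *)
Lemma noetherian_max_open (X : topologicalType) (F : set_system X) :
  noetherian_space X -> F `<=` open -> F !=set0 ->
  exists2 U, F U & forall V, F V -> U `<=` V -> V `<=` U.
Proof.
move=> noethX Fopen [U0 FU0]; apply: contrapT => nomax.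
have grow (U : {U | F U}) :
    {V : {U | F U} | sval U `<=` sval V /\ ~ sval V `<=` sval U}.
  case: U => U FU /=; apply: cid; apply: contrapT => noV; apply: nomax.
  exists U => // V FV UV; apply: contrapT => nVU; apply: noV.
  by exists (exist _ V FV).
have [u [_ u_grow]] := dependent_choice grow (exist _ U0 FU0).
have [|n|N] := noethX (fun n => sval (u n)).
- by move=> n; apply: Fopen; exact: svalP.
- by case: (u_grow n).
- by move=> /(_ N.+1 (leqnSn N)) eqN; have [_] := u_grow N; rewrite eqN; exact.
Qed.

Section Spectrum.
Variable R : comNzRingType.
Implicit Types (P Q : spec R) (E : set R).

Lemma spec_ext P Q : spec_set P = Q -> P = Q.
Proof.
by case: P Q => P PP [Q QP] /= PQ; case: _ / PQ QP => QP; congr Spec.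
Qed.

Lemma spec_lincomb P n (a c : 'I_n -> R) :
  (forall i, spec_set P (a i)) -> spec_set P (\sum_(i < n) c i * a i).
Proof.
case: (spec_prime P) => -[P0 _ PD] _ Pa.
elim/big_rec: _ => [|i x _ Px]; first exact: set_mem P0.
by apply: set_mem; apply: PD; exact: mem_set.
Qed.

Lemma zeros_span n (a : 'I_n -> R) :
  zeros [set x | exists c : 'I_n -> R, x = \sum_(i < n) c i * a i] =
  zeros (range a).
Proof.
apply/seteqP; split=> P Pa.
- move=> _ [i _ <-]; apply: Pa; exists (fun j => (j == i)%:R).
  rewrite (bigD1 i)//= eqxx mul1r big1 ?addr0 // => j /negbTE ->.
  by rewrite mul0r.
- by move=> _ [c ->]; apply: spec_lincomb => i; apply: Pa; exists i.
Qed.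

Hypothesis noethR : noetherian_space (zariski_spec R).

Lemma noetherian_zeros_min (F : set (set R)) : F !=set0 ->
  exists2 E, F E & forall E', F E' -> zeros E' `<=` zeros E ->
    zeros E `<=` zeros E'.
Proof.
move=> [E0 FE0].
have [||_ [E FE <-] Emax] := @noetherian_max_open _
    [set (~` zeros E : set (zariski_spec R)) | E in F] noethR.
- by move=> _ [E _ <-]; exists E.
- by exists (~` zeros E0); exists E0.
exists E => // E' FE' E'E; rewrite -(setCS (zeros E')).
by apply: Emax; [exists E'|rewrite setCS].
Qed.

(** Choose a finite subset of [E] with the smallest zero set: adjoining a
    further element of [E] cannot shrink it, so every prime containing the
    finite subset contains [E]. *)
Lemma noetherian_zeros_fg E :
  exists2 I, fg_ideal I & zeros I = zeros E.
Proof.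
have [|_ [n [a [<- aE]]] amin] := @noetherian_zeros_min
    [set A | exists n (a : 'I_n -> R), range a = A /\ A `<=` E].
  by exists set0, 0%N, (fun=> 0); split=> //; rewrite -subset0 => x [[]].
exists [set x | exists c : 'I_n -> R, x = \sum_(i < n) c i * a i].
  by exists n, a.
rewrite zeros_span; apply/seteqP; split=> P; last exact: subset_trans.
move=> Pa x Ex; pose b (i : 'I_n.+1) := oapp a x (unlift ord0 i).
have bE : range b = x |` range a.
  apply/seteqP; split=> y.
    move=> [i _ <-]; rewrite /b.
    by case: unliftP => [j _|_]; [right; exists j|left].
  case=> [->|[i _ <-]]; first by exists ord0; rewrite // /b unlift_none.
  by exists (lift ord0 i); rewrite // /b liftK.
apply: (amin (range b) _ _ P Pa).
- by exists n.+1, b; split=> //; rewrite bE => y [->|/aE].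
- by move=> Q Qb y ay; apply: Qb; rewrite bE; right.
- by rewrite bE; left.
Qed.

Lemma inverse_open_zeros E : open (zeros E : set (inverse_spec R)).
Proof.
have [I fgI <-] := noetherian_zeros_fg E.
exists [set zeros I]; last by rewrite bigcup_set1.
by move=> _ ->; exact: finI_from1.
Qed.

(** The complement of [Y] is stable under passing to larger primes, hence is
    the union of the open sets [zeros P] for [P] outside [Y]. *)
Lemma inverse_closed_generization_stable (Y : set (spec R)) :
  (forall P Q, Y Q -> P `<=` Q -> Y P) -> closed (Y : set (inverse_spec R)).
Proof.
move=> Ygen.
have -> : Y = ~` \bigcup_(P in ~` Y) zeros P.
  apply/seteqP; split=> [P YP [Q nYQ QP]|P nP]; first exact/nYQ/(Ygen Q P).
  by apply: contrapT => nYP; apply: nP; exists P.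
apply: open_closedC; apply: bigcup_open => P _; exact: inverse_open_zeros.
Qed.

Definition strictly_contains P Q : Prop := Q `<=` P /\ ~ P `<=` Q.

(** A prime [P] is recovered from [zeros P] as its least element, so a minimal
    zero set among those of the inaccessible primes comes from a maximal
    inaccessible prime, which is absurd. *)
Lemma noetherian_spec_acc : well_founded strictly_contains.
Proof.
move=> P; apply: contrapT => nP.
have [|_ [Q nQ <-] Qmin] := @noetherian_zeros_min
   [set spec_set Q | Q in [set Q | ~ Acc strictly_contains Q]].
  by exists P, P.
apply: nQ; split=> P' [QP' nP'Q]; apply: contrapT => nP'; apply: nP'Q.
by apply: (Qmin P') => //; [exists P'|move=> S; exact: subset_trans].
Qed.

(** * The layering *)

(** [None] is the added last point, the index of the empty layer. *)
Definition removed_before (a b : option (zariski_spec R)) : Prop :=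
  match a, b with
  | Some P, Some Q => strictly_contains P Q
  | Some _, None => True
  | None, _ => False
  end.

Lemma removed_before_wf : well_founded removed_before.
Proof.
have accS P : Acc removed_before (Some P).
  elim/(well_founded_ind noetherian_spec_acc): P => P IH; split=> -[Q|//].
  exact: IH.
by case=> [P|]; [exact: accS|split=> -[]].
Qed.

Lemma noetherian_compactly_layered : compactly_layered R.
Proof.
have [le [le_wo le_ext]] := well_order_extension removed_before_wf.
pose W : orderType _ := well_ordered le_wo.
have before_lt (a b : W) : removed_before a b -> (a < b)%O.
  by move=> /le_ext; rewrite -[le _ _]/(b <= a)%O -ltNge.
pose Y (a : W) : set (spec R) := [set P | (a <= (Some P : W))%O].
exists _, W, Y; split.
- exact: le_wo.
- by move=> a a0; apply/seteqP; split=> // P _; exact: a0.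
- exists None; apply/seteqP; split=> // P; rewrite /Y /= leNgt => /negP; apply.
  exact: before_lt.
- by move=> a b ba P; exact/le_trans/ltW.
split.
- move=> a [_ alim]; apply/seteqP; split=> P.
    by move=> aP b ba; exact: le_trans (ltW ba) aP.
  (* If [P] were before [a] but in all earlier layers, no index could lie
     strictly between [P] and [a], and [a] would be the successor of [P]. *)
  move=> aP; rewrite /Y /= leNgt; apply/negP => Pa; apply: alim.
  exists (Some P); split=> // b Pb; rewrite leNgt; apply/negP => ba.
  by have /(lt_le_trans Pb) := aP b ba; rewrite ltxx.
- move=> a; apply: inverse_closed_generization_stable => P Q aQ PQ.
  have [QP|nQP] := pselect (spec_set Q `<=` P); last first.
    by apply: le_trans aQ (ltW _); apply: before_lt.
  by rewrite -(@spec_ext Q P) //; exact/seteqP.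
- move=> a a' [aa' a'min] P [aP /negP]; rewrite -ltNge => Pa'.
  split=> // Q aQ PQ.
  have aE : a = Some P.
    apply/eqP; rewrite eq_le aP /= leNgt; apply/negP => /a'min.
    by rewrite leNgt Pa'.
  apply/seteqP; split=> //; apply: contrapT => nQP.
  have := before_lt (Some Q) (Some P) (conj PQ nQP).
  by rewrite -aE ltNge aQ.
Qed.

End Spectrum.

Theorem corollary9p2 (D : idomainType) (hD : prufer_domain D)
  (hN : noetherian_space (zariski_spec D)) : compactly_layered D.
Proof. exact: noetherian_compactly_layered hN. Qed.
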